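(* Let $G=(V,E)$ be a graph with $n$ vertices and let $S$ be a $(\kappa,\tau)$-regular subset of $V$ with cardinality $n_1$. If $\tau-\kappa\le 1$, then $$S_L(G)\ \ge\ \Delta+1-\frac{\tau n}{n_1}.$$ If equality holds, then there exists an integer $s$ such that $d_{S^c}(v)=s$ for all $v\in S$ and $sn_1=\tau(n-n_1)$; moreover, $\mu_1=\Delta+1$ and $a(G)=\frac{\tau n}{n_1}$.
   Context: Graphs are finite, simple and undirected. For a graph $G$ with $n$ vertices, $L(G)=D(G)-A(G)$ is the Laplacian matrix ($D(G)$ the diagonal matrix of vertex degrees, $A(G)$ the adjacency matrix), with eigenvalues $\mu_1\ge\dots\ge\mu_{n-1}\ge\mu_n=0$. The algebraic connectivity is $a(G)=\mu_{n-1}$ and the Laplacian spread is $S_L(G)=\mu_1-a(G)$. $\Delta$ is the maximum vertex degree of $G$. For $Y\subseteq V$, $Y^c=V\setminus Y$ and $d_Y(v)$ is the number of neighbors of $v$ in $Y$. A nonempty proper subset $S$ of $V$ is $(\kappa,\tau)$-regular if the subgraph induced by $S$ is $\kappa$-regular and every vertex in $S^c$ has exactly $\tau$ neighbors in $S$.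
   Formalization: The graph G is additionally assumed to have at least one edge; for an edgeless graph on at least two vertices any nonempty proper S is (0,0)-regular and the stated inequality would read 0 ≥ 1. *)

(* Defs.v *)
From HB Require Import structures.
From mathcomp Require Import all_boot all_order all_algebra.
From mathcomp Require Export polyrcf.

Set Implicit Arguments.
Unset Strict Implicit.
Unset Printing Implicit Defensive.

Import Order.TTheory GRing.Theory Num.Theory.
Local Open Scope ring_scope.

Record sgraph := SGraph {
  vertex :> finType;
  adj : rel vertex;
  adj_sym : symmetric adj;
  adj_irr : irreflexive adj }.

Section Degrees.
Variable G : sgraph.
Implicit Types (Y S : {set G}) (v : G).

Definition deg_in Y v : nat := #|[set w in Y | adj v w]|.

Definition degree v : nat := deg_in [set: G] v.

Definition max_degree : nat := \max_(v : G) degree v.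

(* For v in S, deg_in S v is the degree of v in the subgraph induced by S. *)
Definition regular_subset (kappa tau : nat) S : Prop :=
  [/\ S != set0, S \proper [set: G],
      {in S, forall v, deg_in S v = kappa} &
      {in ~: S, forall v, deg_in S v = tau}].

End Degrees.

Section Spectrum.
Variable R : rcfType.

(* The roots of the characteristic polynomial that lie in R, in nonincreasing
   order and repeated according to multiplicity (for a symmetric M over the
   real closed field R these are all n eigenvalues). *)
Definition spectrum n (M : 'M[R]_n) : seq R :=
  flatten [seq nseq (mup x (char_poly M)) x | x <- rev (rootsR (char_poly M))].

Variable G : sgraph.

(* Rows and columns are indexed through the enumeration enum_val of G. *)
Definition adj_mx : 'M[R]_#|G| :=
  \matrix_(i, j) (adj (enum_val i) (enum_val j))%:R.

Definition degree_mx : 'M[R]_#|G| := diag_mx (\row_i (degree (enum_val i))%:R).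

Definition laplacian : 'M[R]_#|G| := degree_mx - adj_mx.

(* Counted from 1: lap_eig 1 is the largest eigenvalue, lap_eig #|G| the
   smallest. *)
Definition lap_eig (k : nat) : R := (spectrum laplacian)`_k.-1.

Definition alg_connectivity : R := lap_eig #|G|.-1.

Definition lap_spread : R := lap_eig 1 - alg_connectivity.

End Spectrum.

(* Main.v *)
Require Import Defs.
From mathcomp Require Import all_boot all_order all_algebra.
From mathcomp Require Import perm sesquilinear spectral complex ring lra.

Set Implicit Arguments.
Unset Strict Implicit.
Unset Printing Implicit Defensive.

Import Order.TTheory GRing.Theory Num.Theory.
Local Open Scope ring_scope.

(** Both eigenvalues are compared with Rayleigh quotients of the Laplacian,
    through the identity [x L x^T = 1/2 sum_v sum_w adj v w (x_v - x_w)^2]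
    ([vec_laplacian]); the right-hand side is called [dirichlet] below.

    - [mu_1 >= Delta + 1]: take a vertex [v] of degree [Delta] and the vector
      equal to [Delta] at [v], [-1] at its neighbors and [0] elsewhere. The
      edges at [v] alone contribute [Delta (Delta + 1)^2], while the squared
      norm is [Delta (Delta + 1)] ([lap_eig1_ge_degree]).

    - [a(G) <= tau n / n1]: the vector [1_S - n1/n] is orthogonal to the
      constants, and its Rayleigh quotient is exactly [tau n / n1], because
      the [tau (n - n1)] edges between [S] and its complement are the only
      ones that count ([rayleigh_cut]).

    Subtracting gives the bound, and equality in the difference forces
    equality in both estimates. Then [1_S - n1/n] minimizes the Rayleigh
    quotient on the orthogonal of the constants, hence is a critical point
    of it ([fiedler_critical]). Testing criticality against the difference of
    the indicators of two vertices of [S] shows that they have the same number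
    of neighbors outside [S]; counting the edges leaving [S] from both ends
    gives the integer relation.

    The link with the list [spectrum], defined by roots of the characteristic
    polynomial, is the spectral theorem for real symmetric matrices. It is
    obtained over the complex numbers [R[i]] from the diagonalization of
    Hermitian matrices; the eigenvalues are real, but the eigenvectors are
    complex, so the variational arguments are carried out on complex vectors
    and the conclusions are then read in [R]. *)

(** * The spectrum of a real symmetric matrix *)

Lemma char_poly_similar (F : fieldType) n (P D : 'M[F]_n) :
  P \in unitmx -> char_poly (invmx P *m D *m P) = char_poly D.
Proof.
move=> uP; rewrite /char_poly.
pose Q := map_mx polyC P; pose Q' := map_mx polyC (invmx P).
have QQ : Q' *m Q = 1%:M by rewrite -map_mxM mulVmx // map_mx1.
have -> : char_poly_mx (invmx P *m D *m P) = Q' *m char_poly_mx D *m Q.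
  rewrite /char_poly_mx mulmxBr mulmxBl !map_mxM -/Q -/Q'; congr (_ - _).
  by rewrite scalar_mxC -mulmxA QQ mulmx1.
by rewrite !det_mulmx mulrAC -det_mulmx QQ det1 mul1r.
Qed.

Lemma pairwise_flatten_nseq (R : numDomainType) (m : R -> nat) (s : seq R) :
  pairwise >%R s -> pairwise >=%R (flatten [seq nseq (m x) x | x <- s]).
Proof.
elim: s => //= x s IH /andP[xs /IH{}IH]; rewrite pairwise_cat IH andbT.
apply/andP; split.
  apply/allrelP => y z /nseqP[-> _] /flattenP[t /mapP[w ws ->] /nseqP[-> _]].
  by apply: ltW; apply: (allP xs).
by elim: (m x) => //= k ->; rewrite andbT; apply/allP => y /nseqP[-> _]; apply: lexx.
Qed.

Lemma spectrum_pairwise (R : rcfType) n (M : 'M[R]_n) :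
  pairwise >=%R (spectrum M).
Proof.
apply: pairwise_flatten_nseq; rewrite -sorted_pairwise ?rev_sorted.
  exact: sorted_roots.
by move=> x y z /= yx zy; apply: lt_trans yx.
Qed.

(** Once the characteristic polynomial is known to split over [R], multiplicities
    of roots are numbers of occurrences of factors, so no eigenvalue is missing
    from [spectrum M]. *)
Lemma spectrum_perm (R : rcfType) n (M : 'M[R]_n) (r : seq R) :
  char_poly M = \prod_(x <- r) ('X - x%:P) -> perm_eq (spectrum M) r.
Proof.
move=> Mr; apply: perm_trans (perm_count_undup r); rewrite /spectrum.
under eq_map do rewrite Mr mu_prod_XsubC.
apply: perm_flatten; apply: perm_map; rewrite perm_rev.
apply: uniq_perm; [|exact: undup_uniq|].
  by apply: (sorted_uniq lt_trans ltxx); apply: sorted_roots.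
move=> x; rewrite mem_undup.
have p0 : char_poly M != 0 by rewrite monic_neq0 ?char_poly_monic.
by have := roots_on_rootsR p0 x; rewrite in_itv /= => <-; rewrite Mr root_prod_XsubC.
Qed.

Section SpectralTheorem.
Local Open Scope sesquilinear_scope.

(** The Hermitian spectral theorem over [R[i]] gives a unitary basis of
    eigenvectors with real eigenvalues. Its order is arbitrary; permuting the
    rows of the unitary matrix makes it agree with that of [spectrum M]. *)
Lemma spectral_decomposition (R : rcfType) n (M : 'M[R]_n) :
  M^T = M ->
  size (spectrum M) = n /\
  exists2 P : 'M[R[i]]_n, P *m P^t* = 1%:M &
    map_mx (real_complex R) M =
    P^t* *m diag_mx (\row_i ((spectrum M)`_i)%:C%C) *m P.
Proof.
move=> Msym; set Mc := map_mx _ M.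
have Mh : Mc \is hermsymmx.
  apply: realsym_hermsym.
    apply/is_hermitianmxP; rewrite expr0 scale1r map_mx_id //.
    by rewrite /Mc map_trmx Msym.
  by apply/mxOverP => i j; rewrite mxE complex_real.
have /orthomx_spectralP MP := hermitian_normalmx Mh.
have /mxOverP dreal := hermitian_spectral_diag_real Mh.
have := spectral_unitarymx Mc.
move: MP dreal; set P := spectralmx Mc; move: (spectral_diag Mc) => d MP dreal uP.
pose r := [tuple complex.Re (d 0 i) | i < n].
have chM : char_poly M = \prod_(x <- r) ('X - x%:P).
  apply: (map_poly_inj (real_complex R)).
  rewrite map_char_poly -/Mc MP char_poly_similar ?unitarymx_unit //.
  rewrite char_poly_trig ?diag_mx_is_trig // big_tuple rmorph_prod.
  apply: eq_bigr => i _; rewrite mxE eqxx mulr1n tnth_mktuple rmorphB /= map_polyX map_polyC /=.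
  by rewrite RRe_real.
have perm := spectrum_perm chM.
split; first by rewrite (perm_size perm) size_tuple.
have /tuple_permP [s sE] := perm.
have sE' (i : 'I_n) : (spectrum M)`_i = complex.Re (d 0 (s i)).
  by rewrite sE -(tnth_nth 0 [tuple tnth r (s i) | i < n]) !tnth_mktuple.
have dE (k : 'I_n) : ((spectrum M)`_k)%:C%C = d 0 (s k) by rewrite sE' RRe_real.
exists (row_perm s P).
  apply/matrixP => i j; have /matrixP/(_ (s i) (s j)) := unitarymxP uP.
  rewrite !mxE (inj_eq perm_inj) => <-; apply: eq_bigr => k _.
  by rewrite !mxE.
rewrite MP invmx_unitary // !mul_mx_diag.
apply/matrixP => i j; rewrite !mxE (reindex_inj (@perm_inj _ s)).
by apply: eq_bigr => k _; rewrite !mxE -dE.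
Qed.

(** In coordinates on a unitary eigenbasis, the quadratic form of [M] is a
    weighted sum of the eigenvalues whose weights add up to the squared norm. *)
Lemma spectral_weights (R : rcfType) n (M : 'M[R]_n) : M^T = M ->
  exists P : 'M[R[i]]_n, forall v : 'rV[R[i]]_n,
    (v *m map_mx (real_complex R) M *m v^t*) 0 0
      = \sum_(i < n) ((spectrum M)`_i)%:C%C * `|(v *m P) 0 i| ^+ 2 /\
    (v *m v^t*) 0 0 = \sum_(i < n) `|(v *m P) 0 i| ^+ 2.
Proof.
move=> /spectral_decomposition[_ [P uP MP]].
exists (P^t*) => v.
have PE : (v *m P^t*)^t* = P *m v^t*.
  rewrite trmx_mul map_mxM; congr (_ *m _).
  by apply/matrixP => i j; rewrite !mxE; exact: conjCK.
split.
  rewrite MP !mulmxA -mulmxA -PE mul_mx_diag mxE; apply: eq_bigr => i _.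
  by rewrite normCK !mxE mulrAC mulrC.
have -> : v *m v^t* =
    v *m P^t* *m (v *m P^t*)^t*.
  by rewrite PE mulmxA -[_ *m P]mulmxA (mulmx1C uP) mulmx1.
by rewrite mxE; apply: eq_bigr => i _; rewrite normCK !mxE.
Qed.

(** On the complex plane spanned by two real vectors that are orthogonal for a
    real symmetric form, the Hermitian extension of the form is diagonal. *)
Lemma form_lincomb (R : rcfType) n (M : 'M[R]_n) (u x : 'rV[R]_n) (a b : R[i]) :
  M^T = M -> u *m M *m x^T = 0 ->
  let v := a *: map_mx (real_complex R) u + b *: map_mx (real_complex R) x in
  (v *m map_mx (real_complex R) M *m v^t*) 0 0
    = `|a| ^+ 2 * ((u *m M *m u^T) 0 0)%:C%C
      + `|b| ^+ 2 * ((x *m M *m x^T) 0 0)%:C%C.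
Proof.
move=> Msym uMx v.
have xMu : x *m M *m u^T = 0.
  by apply: trmx_inj; rewrite !trmx_mul trmxK Msym mulmxA uMx trmx0.
have conjR m (w : 'rV[R]_m) : (map_mx (real_complex R) w)^t*
    = map_mx (real_complex R) w^T.
  by apply/matrixP => i j; rewrite !mxE; apply/CrealP; rewrite complex_real.
have -> : v^t* = a^* *: map_mx (real_complex R) u^T
    + b^* *: map_mx (real_complex R) x^T.
  by rewrite /v !linearD !linearZ /= map_mxD !map_mxZ !conjR.
rewrite /v !mulmxDl !mulmxDr -!scalemxAl -!scalemxAr -!map_mxM uMx xMu.
rewrite !map_mx0 !scaler0 addr0 add0r !scalerA -!normCK.
by rewrite !mxE.
Qed.

Lemma rayleigh_le_spectrum0 (R : rcfType) n (M : 'M[R]_n) (x : 'rV[R]_n) : M^T = M ->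
  (x *m M *m x^T) 0 0 <= (spectrum M)`_0 * (x *m x^T) 0 0.
Proof.
move=> Msym; have [P PM] := spectral_weights Msym.
have x0 : (0 : 'rV_n) *m M *m x^T = 0 by rewrite !mul0mx.
have x01 : (0 : 'rV_n) *m 1%:M *m x^T = 0 by rewrite !mul0mx.
(* The case u = 0, a = 0, b = 1 reads the complex form at a real vector. *)
have := form_lincomb 0 1 Msym x0; have := form_lincomb 0 1 (trmx1 _ n) x01.
rewrite /= !normr0 !expr0n /= !mul0r !add0r !normr1 !expr1n !mul1r map_mx1 !mulmx1.
rewrite scale0r scale1r add0r => xxE xMxE.
have [] := PM (map_mx (real_complex R) x); rewrite xxE xMxE => qE nE.
rewrite -lecR qE rmorphM /= nE mulr_sumr; apply: ler_sum => i _.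
rewrite ler_wpM2r ?exprn_ge0 // lecR.
have [->//|i0] := eqVneq (i : nat) 0%N.
have := spectrum_pairwise M; move=> /pairwiseP-/(_ 0 0%N i); apply.
- by rewrite inE (spectral_decomposition Msym).1 (leq_trans _ (ltn_ord i)).
- by rewrite inE (spectral_decomposition Msym).1.
- by rewrite lt0n.
Qed.

End SpectralTheorem.

Lemma norm2E (R : rcfType) n (w : 'rV[R]_n) :
  (w *m w^T) 0 0 = \sum_i w 0 i ^+ 2.
Proof. by rewrite mxE; apply: eq_bigr => i _; rewrite mxE expr2. Qed.

Lemma norm2_ge0 (R : rcfType) n (w : 'rV[R]_n) : 0 <= (w *m w^T) 0 0.
Proof. by rewrite norm2E sumr_ge0 // => i _; exact: sqr_ge0. Qed.

Lemma norm2_gt0 (R : rcfType) n (w : 'rV[R]_n) :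
  w != 0 -> 0 < (w *m w^T) 0 0.
Proof.
move=> w0; rewrite lt_def norm2_ge0 andbT norm2E.
apply: contra w0 => /eqP s0; apply/eqP/rowP => i; rewrite mxE.
apply/eqP; rewrite -sqrf_eq0; apply/eqP.
by apply: (psumr_eq0P _ s0) => // j _; exact: sqr_ge0.
Qed.

(** The second smallest eigenvalue is at most the largest Rayleigh quotient on
    any plane: such a plane contains a nonzero vector [v] orthogonal to the last
    eigenvector, and for that [v] every weight sits on an eigenvalue that is at
    least the second smallest one. *)
Lemma spectrum_second_min_le (R : rcfType) n (M : 'M[R]_n) (u x : 'rV[R]_n) (rho : R) :
  M^T = M -> u != 0 -> x != 0 -> u *m x^T = 0 -> u *m M *m x^T = 0 ->
  (u *m M *m u^T) 0 0 <= rho * (u *m u^T) 0 0 ->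
  (x *m M *m x^T) 0 0 <= rho * (x *m x^T) 0 0 ->
  (spectrum M)`_n.-2 <= rho.
Proof.
move=> Msym u0 x0 ux uMx qu qx; have [P PM] := spectral_weights Msym.
case: n => [|n] in M u x Msym u0 x0 ux uMx qu qx P PM *.
  by case/negP: u0; apply/eqP/rowP => -[].
pose uc := map_mx (real_complex R) u; pose xc := map_mx (real_complex R) x.
(* The eigenvectors being complex, so are the coefficients of v. *)
have [a [b [ab0 lab]]] : exists a b : R[i], (a != 0) || (b != 0) /\
    ((a *: uc + b *: xc) *m P) 0 ord_max = 0.
  have [z|z] := eqVneq ((uc *m P) 0 ord_max) 0.
    by exists 1, 0; rewrite oner_eq0 scale1r scale0r addr0.
  exists (- (xc *m P) 0 ord_max), ((uc *m P) 0 ord_max); rewrite z orbT; split => //.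
  rewrite mulmxDl -!scalemxAl !mxE; ring.
have ux1 : u *m 1%:M *m x^T = 0 by rewrite mulmx1.
have := form_lincomb a b Msym uMx; have := form_lincomb a b (trmx1 _ n.+1) ux1.
rewrite /= map_mx1 !mulmx1 -/uc -/xc; set v := _ + _ => nE qE.
have [] := PM v; rewrite qE nE => qS nS.
have v_gt0 : 0 < \sum_(i < n.+1) `|(v *m P) 0 i| ^+ 2.
  have ge0 (c : R[i]) (w : 'rV_n.+1) :
      0 <= `|c| ^+ 2 * ((w *m w^T) 0 0)%:C%C.
    by rewrite mulr_ge0 ?exprn_ge0 // ler0c norm2_ge0.
  have gt0 (c : R[i]) (w : 'rV_n.+1) :
      c != 0 -> w != 0 -> 0 < `|c| ^+ 2 * ((w *m w^T) 0 0)%:C%C.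
    by move=> c0 w0; rewrite mulr_gt0 ?exprn_gt0 ?normr_gt0 // ltcR norm2_gt0.
  rewrite -nS; case/orP: ab0 => h.
    by apply: ltr_wpDr; [exact: ge0 | exact: gt0].
  by apply: ltr_wpDl; [exact: ge0 | exact: gt0].
rewrite -lecR -(ler_pM2r v_gt0).
apply: (@le_trans _ _ (\sum_(i < n.+1) ((spectrum M)`_i)%:C%C * `|(v *m P) 0 i| ^+ 2)).
  rewrite mulr_sumr; apply: ler_sum => i _.
  have [->|im] := eqVneq i ord_max; first by rewrite lab normr0 expr0n /= !mulr0.
  rewrite ler_wpM2r ?exprn_ge0 // lecR.
  have [->//|i0] := eqVneq (i : nat) n.-1%N.
  have ilt : (i < n)%N by rewrite ltn_neqAle -ltnS ltn_ord andbT.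
  have := spectrum_pairwise M; move=> /pairwiseP-/(_ 0 i n.-1); apply.
  - by rewrite inE (spectral_decomposition Msym).1.
  - by rewrite inE (spectral_decomposition Msym).1 ltnS leq_pred.
  - by rewrite ltn_neqAle i0 -ltnS prednK // (leq_ltn_trans _ ilt).
rewrite -qS -nS mulrDr ![rho%:C%C * (_ * _)]mulrCA -!rmorphM /=.
by apply: lerD; rewrite ler_wpM2l ?exprn_ge0 // lecR.
Qed.

(** * The Dirichlet form of a graph *)

Lemma sum_enum_val (R : nmodType) (I : finType) (F : I -> R) :
  \sum_(i < #|I|) F (enum_val i) = \sum_v F v.
Proof. by rewrite -big_enum_val. Qed.

Section Dirichlet.
Variables (R : rcfType) (G : sgraph).
Implicit Types (f g h : G -> R) (S : {set G}) (v w : G).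

Definition vec f : 'rV[R]_#|G| := \row_i f (enum_val i).

Definition dot f g : R := \sum_v f v * g v.

Definition dirichlet f g : R :=
  2^-1 * \sum_v \sum_w (adj v w)%:R * ((f v - f w) * (g v - g w)).

Definition lap_op g v : R := \sum_w (adj v w)%:R * (g v - g w).

Lemma vec_dot f g : (vec f *m (vec g)^T) 0 0 = dot f g.
Proof.
rewrite mxE /dot -[RHS]sum_enum_val; apply: eq_bigr => i _.
by rewrite !mxE.
Qed.

Lemma deg_inE S v : (deg_in S v)%:R = \sum_(w in S) (adj v w)%:R :> R.
Proof.
rewrite -natr_sum; congr _%:R; rewrite /deg_in -sum1_card big_mkcond [RHS]big_mkcond.
by apply: eq_bigr => w _; rewrite inE; case: (w \in S); case: adj.
Qed.

(** Summation by parts: each edge is met from both of its ends. *)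
Lemma dirichletE f g : dirichlet f g = dot f (lap_op g).
Proof.
rewrite /dirichlet.
have -> : \sum_v \sum_w (adj v w)%:R * ((f v - f w) * (g v - g w))
    = dot f (lap_op g) + dot f (lap_op g).
  rewrite /dot /lap_op; under [X in X + _]eq_bigr do rewrite mulr_sumr.
  under [X in _ + X]eq_bigr do rewrite mulr_sumr.
  rewrite [X in _ + X]exchange_big -big_split; apply: eq_bigr => v _ /=.
  rewrite -big_split; apply: eq_bigr => w _ /=; rewrite (adj_sym w v); ring.
by field.
Qed.

Lemma laplacian_sym : (laplacian R G)^T = laplacian R G.
Proof.
rewrite /laplacian linearB /= tr_diag_mx; congr (_ - _).
by apply/matrixP => i j; rewrite !mxE adj_sym.
Qed.

Lemma vec_laplacian f g :
  (vec f *m laplacian R G *m (vec g)^T) 0 0 = dirichlet f g.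
Proof.
rewrite dirichletE -vec_dot -mulmxA; congr ((_ *m _) 0 0).
apply/matrixP => i j; rewrite /laplacian /degree_mx mulmxBl mul_diag_mx !mxE.
rewrite /lap_op /degree deg_inE; under [RHS]eq_bigr do rewrite mulrBr.
rewrite sumrB -mulr_suml; congr (_ * _ - _).
  by apply: eq_bigl => w; rewrite inE.
by rewrite -[RHS]sum_enum_val; apply: eq_bigr => k _; rewrite !mxE.
Qed.

Lemma dirichletC f g : dirichlet f g = dirichlet g f.
Proof.
congr (_ * _); apply: eq_bigr => v _; apply: eq_bigr => w _.
by rewrite [(f v - _) * _]mulrC.
Qed.

Lemma eq_dirichlet f f' g g' :
  (forall v w, f v - f w = f' v - f' w) -> (forall v w, g v - g w = g' v - g' w) ->
  dirichlet f g = dirichlet f' g'.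
Proof.
move=> ff gg; congr (_ * _); apply: eq_bigr => v _; apply: eq_bigr => w _.
by rewrite ff gg.
Qed.

(** Edges at [v] occur in the double sum both in row [v] and in column [v],
    which compensates the factor 1/2; all other terms are nonnegative. *)
Lemma dirichlet_star f v : \sum_w (adj v w)%:R * (f v - f w) ^+ 2 <= dirichlet f f.
Proof.
pose t u w := (adj u w)%:R * (f u - f w) ^+ 2.
have t0 u w : 0 <= t u w by rewrite mulr_ge0 ?ler0n ?sqr_ge0.
have ts u w : t u w = t w u by rewrite /t adj_sym -sqrrN opprB.
have -> : dirichlet f f = 2^-1 * \sum_u \sum_w t u w.
  by congr (_ * _); apply: eq_bigr => u _; apply: eq_bigr => w _; rewrite /t expr2.
rewrite [in leRHS](bigD1 v) //=.
have : \sum_w t v w <= \sum_(u | u != v) \sum_w t u w.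
  have -> : \sum_w t v w = \sum_(u | u != v) t u v.
    rewrite (bigD1 v) //= {1}/t adj_irr mul0r add0r.
    by apply: eq_bigr => u _; rewrite ts.
  apply: ler_sum => u _; rewrite (bigD1 v) //= lerDl.
  by apply: sumr_ge0.
rewrite -[leLHS]/(\sum_w t v w).
move: (\sum_w t v w) (\sum_(u | u != v) _) => a b ab; lra.
Qed.

Lemma dirichlet_ge0 f : 0 <= dirichlet f f.
Proof.
rewrite mulr_ge0 ?invr_ge0 ?ler0n // sumr_ge0 // => v _; rewrite sumr_ge0 // => w _.
by rewrite mulr_ge0 ?ler0n // -expr2 sqr_ge0.
Qed.

Lemma dot_ge0 f : 0 <= dot f f.
Proof. by rewrite sumr_ge0 // => v _; rewrite -expr2 sqr_ge0. Qed.

Lemma lap_eig1_ge f : dirichlet f f <= lap_eig R G 1 * dot f f.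
Proof. rewrite -vec_laplacian -vec_dot; exact: rayleigh_le_spectrum0 laplacian_sym. Qed.

(** The plane spanned by [f] and the constants realizes the min-max principle,
    as the Dirichlet form vanishes on constants. *)
Lemma alg_connectivity_le f : \sum_v f v = 0 ->
  alg_connectivity R G * dot f f <= dirichlet f f.
Proof.
move=> f0; have [d0|d0] := eqVneq (dot f f) 0.
  by rewrite d0 mulr0 dirichlet_ge0.
have dp : 0 < dot f f by rewrite lt_def d0 dot_ge0.
have one0 h : dirichlet (fun=> 1) h = 0.
  rewrite /dirichlet big1 ?mulr0 // => v _; rewrite big1 // => w _.
  by rewrite subrr mul0r mulr0.
have fN0 : vec f != 0.
  by apply: contra d0 => /eqP f00; rewrite -vec_dot f00 mul0mx mxE.
have mx11 (A : 'M[R]_1) : A 0 0 = 0 -> A = 0.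
  by move=> A0; apply/matrixP => i j; rewrite !ord1 A0 mxE.
rewrite -ler_pdivlMr //.
apply: (@spectrum_second_min_le _ _ (laplacian R G) (vec (fun=> 1)) (vec f)).
- exact: laplacian_sym.
- apply: contra fN0 => /eqP/rowP o0; apply/eqP/rowP => i.
  by have := o0 i; rewrite !mxE => /eqP; rewrite oner_eq0.
- exact: fN0.
- by apply: mx11; rewrite vec_dot -[RHS]f0; apply: eq_bigr => v _; rewrite mul1r.
- by apply: mx11; rewrite vec_laplacian one0.
- by rewrite vec_laplacian vec_dot one0 mulr_ge0 ?dot_ge0 // divr_ge0 ?dot_ge0 ?dirichlet_ge0.
- by rewrite vec_laplacian vec_dot divfK.
Qed.

(** A quadratic polynomial that is nonnegative and vanishes at 0 has a double
    root there. *)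
Lemma lin_coef_eq0 (b c : R) :
  (forall t, 0 <= t * b *+ 2 + t ^+ 2 * c) -> b = 0.
Proof.
move=> H; have c0 : 0 <= c by have := H 1; have := H (-1); lra.
have c1 : c + 1 != 0 by rewrite gt_eqF //; lra.
(* c + 1 stands for c, to avoid dividing by zero when c = 0. *)
have := H (- b / (c + 1)).
have -> : - b / (c + 1) * b *+ 2 + (- b / (c + 1)) ^+ 2 * c
  = - ((b / (c + 1)) ^+ 2 * (c + 2)) by field.
rewrite oppr_ge0 pmulr_lle0 => [|]; last by lra.
move=> h; apply/eqP; have : (b / (c + 1)) ^+ 2 == 0 by rewrite eq_le h sqr_ge0.
by rewrite sqrf_eq0 mulf_eq0 invr_eq0 (negbTE c1) orbF.
Qed.

(** A minimizer of the Rayleigh quotient on the orthogonal of the constants is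
    an eigenvector in the weak sense: the first variation vanishes in every
    admissible direction. *)
Lemma fiedler_critical f g : \sum_v f v = 0 -> \sum_v g v = 0 ->
  dirichlet f f = alg_connectivity R G * dot f f ->
  dirichlet f g = alg_connectivity R G * dot f g.
Proof.
move=> f0 g0 ff; set a := alg_connectivity R G in ff *.
apply/eqP; rewrite -subr_eq0; apply/eqP.
apply: (@lin_coef_eq0 _ (dirichlet g g - a * dot g g)) => t.
have h0 : \sum_v (f v + t * g v) = 0.
  by rewrite big_split /= -mulr_sumr f0 g0 mulr0 addr0.
have := alg_connectivity_le h0; rewrite -/a -subr_ge0.
have -> : dot (fun v => f v + t * g v) (fun v => f v + t * g v)
    = dot f f + t * dot f g *+ 2 + t ^+ 2 * dot g g.
  rewrite /dot !mulr_sumr -sumrMnl -!big_split; apply: eq_bigr => v _ /=; ring.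
have -> : dirichlet (fun v => f v + t * g v) (fun v => f v + t * g v)
    = dirichlet f f + t * dirichlet f g *+ 2 + t ^+ 2 * dirichlet g g.
  rewrite /dirichlet ![_ * (2^-1 * _)]mulrCA -mulrnAr -!mulrDr; congr (_ * _).
  rewrite !mulr_sumr -sumrMnl -!big_split; apply: eq_bigr => v _ /=.
  rewrite !mulr_sumr -sumrMnl -!big_split; apply: eq_bigr => w _ /=; ring.
rewrite ff => h; apply: le_trans h _; rewrite le_eqVlt; apply/orP; left; apply/eqP; ring.
Qed.

Definition indic S v : R := (v \in S)%:R.

Lemma lap_op_indic S v : v \in S -> lap_op (indic S) v = (deg_in (~: S) v)%:R.
Proof.
move=> vS; rewrite deg_inE /lap_op [RHS]big_mkcond; apply: eq_bigr => w _.
by rewrite /indic vS inE; case: (w \in S); rewrite /= ?subrr ?mulr0 ?subr0 ?mulr1.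
Qed.

Lemma dirichlet_indic S :
  dirichlet (indic S) (indic S) = (\sum_(v in S) deg_in (~: S) v)%:R.
Proof.
rewrite dirichletE natr_sum [RHS]big_mkcond; apply: eq_bigr => v _.
rewrite {1}/indic; case: ifP => vS; last by rewrite mul0r.
by rewrite mul1r lap_op_indic.
Qed.

(** The indicators of [S] and of its complement differ by a sign and a constant,
    so they have the same Dirichlet form; this
    and [dirichlet_indic] count the edges leaving [S] from both sides. *)
Lemma dirichlet_indicC S :
  dirichlet (indic S) (indic S) = (\sum_(v in ~: S) deg_in S v)%:R.
Proof.
have := dirichlet_indic (~: S); rewrite setCK => <-.
have H v w : indic S v - indic S w = - (indic (~: S) v - indic (~: S) w).
  by rewrite /indic !inE; case: (v \in S); case: (w \in S); rewrite /=; ring.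
congr (_ * _); apply: eq_bigr => v _; apply: eq_bigr => w _.
by rewrite !H mulrNN.
Qed.

(** The test vector is the eigenvector, for the eigenvalue [d + 1], of the star
    formed by [v] and its [d] neighbors. *)
Lemma lap_eig1_ge_degree v : (0 < degree v)%N -> (degree v)%:R + 1 <= lap_eig R G 1.
Proof.
set d := degree v => d0.
have dE : d%:R = \sum_w (adj v w)%:R :> R.
  by rewrite /d /degree deg_inE; apply: eq_bigl => w; rewrite inE.
pose f w : R := if w == v then d%:R else - (adj v w)%:R.
have := le_trans (dirichlet_star f v) (lap_eig1_ge f).
have -> : \sum_w (adj v w)%:R * (f v - f w) ^+ 2 = d%:R * (d%:R + 1) ^+ 2.
  rewrite {1}dE mulr_suml; apply: eq_bigr => w _; rewrite /f eqxx.
  case: eqVneq => [->|_]; first by rewrite adj_irr !mul0r.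
  by case: adj; rewrite ?mul0r // opprK.
have -> : dot f f = d%:R * (d%:R + 1).
  rewrite /dot (bigD1 v) //= {1 2}/f eqxx mulrDr mulr1; congr (_ + _).
  rewrite dE [RHS](bigD1 v) //= adj_irr add0r; apply: eq_bigr => w /negbTE wv.
  by rewrite /f wv; case: adj => /=; ring.
have dd : 0 < d%:R * (d%:R + 1) :> R by rewrite mulr_gt0 ?ltr_wpDl ?ler0n ?ltr01 ?ltr0n.
by rewrite expr2 mulrA [leRHS]mulrC ler_pM2l.
Qed.

Lemma lap_eig1_ge_max_degree :
  (exists x y : G, adj x y) -> (max_degree G)%:R + 1 <= lap_eig R G 1.
Proof.
move=> [x [y xy]].
have [|v _ vmax] := @eq_bigmax_cond G predT (@degree G); first by apply/card_gt0P; exists x.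
rewrite /max_degree vmax; apply: lap_eig1_ge_degree; rewrite -vmax.
apply: leq_trans (leq_bigmax x); rewrite card_gt0; apply/set0Pn; exists y.
by rewrite !inE.
Qed.

End Dirichlet.

(** * Sets with a constant number of neighbors seen from outside *)

Section RegularSubset.
Variables (R : rcfType) (G : sgraph) (tau : nat) (S : {set G}).
Hypotheses (S0 : S != set0) (SP : S \proper [set: G]).
Hypothesis Stau : {in ~: S, forall v, deg_in S v = tau}.

(** The projection of the indicator of [S] orthogonally to the constants. *)
Let cut (v : G) : R := indic R S v - #|S|%:R / #|G|%:R.

Lemma card_S_gt0 : (0 < #|S|)%N. Proof. by rewrite card_gt0. Qed.

Lemma card_S_lt : (#|S| < #|G|)%N.
Proof. by rewrite -cardsT proper_card. Qed.

Let n_neq0 : #|G|%:R != 0 :> R.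
Proof. by rewrite pnatr_eq0 -lt0n (leq_trans _ card_S_lt). Qed.

Lemma sum_indic : \sum_v indic R S v = #|S|%:R.
Proof.
by rewrite /indic -natr_sum -sum1_card [in RHS]big_mkcond.
Qed.

Lemma sum_cut : \sum_v cut v = 0.
Proof.
by rewrite sumrB sum_indic sumr_const -[X in _ - X]mulr_natr divfK ?subrr.
Qed.

Lemma dot_cut : dot cut cut = #|S|%:R * (#|G|%:R - #|S|%:R) / #|G|%:R.
Proof.
have -> : dot cut cut = \sum_v (indic R S v * (1 - #|S|%:R / #|G|%:R *+ 2)
   + (#|S|%:R / #|G|%:R) ^+ 2).
  apply: eq_bigr => v _; rewrite /cut /indic; case: (v \in S) => /=; ring.
rewrite big_split /= -mulr_suml sum_indic sumr_const -[X in _ + X]mulr_natr.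
by field.
Qed.

Lemma sum_deg_in : (\sum_(v in ~: S) deg_in S v = tau * (#|G| - #|S|))%N.
Proof.
by rewrite (eq_bigr (fun=> tau)) // sum_nat_const mulnC cardsCs setCK.
Qed.

Lemma dirichlet_cut : dirichlet cut cut = tau%:R * (#|G|%:R - #|S|%:R).
Proof.
have sub v w : cut v - cut w = indic R S v - indic R S w by rewrite /cut; ring.
rewrite (eq_dirichlet sub sub) dirichlet_indicC sum_deg_in natrM natrB //.
exact: ltnW card_S_lt.
Qed.

Let gap_gt0 : 0 < #|G|%:R - #|S|%:R :> R.
Proof. by rewrite subr_gt0 ltr_nat card_S_lt. Qed.

Lemma rayleigh_cut : dirichlet cut cut = (tau * #|G|)%:R / #|S|%:R * dot cut cut.
Proof.
rewrite dirichlet_cut dot_cut natrM; field.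
by rewrite n_neq0 pnatr_eq0 -lt0n card_S_gt0.
Qed.

Lemma alg_connectivity_le_regular :
  alg_connectivity R G <= (tau * #|G|)%:R / #|S|%:R.
Proof.
have := alg_connectivity_le sum_cut; rewrite rayleigh_cut ler_pM2r // dot_cut.
by rewrite divr_gt0 ?mulr_gt0 // ltr0n ?card_S_gt0 // (leq_trans _ card_S_lt).
Qed.

(** When the estimate is tight, [cut] is a minimizer. On [S], where it is
    constant, its Laplacian at [v] is the number of neighbors of [v] outside
    [S], so criticality makes this number constant. *)
Lemma regular_of_alg_connectivity_eq :
  alg_connectivity R G = (tau * #|G|)%:R / #|S|%:R ->
  exists s : nat, {in S, forall v, deg_in (~: S) v = s}
                  /\ (s * #|S| = tau * (#|G| - #|S|))%N.
Proof.
move=> aE; have [v0 v0S] := set0Pn _ S0.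
have const : {in S, forall v, deg_in (~: S) v = deg_in (~: S) v0}.
  move=> v vS; pose g w : R := (w == v)%:R - (w == v0)%:R.
  have pick (h : G -> R) u : \sum_w (w == u)%:R * h w = h u.
    rewrite (bigD1 u) //= eqxx mul1r big1 ?addr0 // => w /negbTE ->.
    by rewrite mul0r.
  have dotg h : dot g h = h v - h v0.
    by rewrite /dot; under eq_bigr do rewrite mulrBl; rewrite sumrB !pick.
  have g0 : \sum_w g w = 0.
    by have := dotg (fun=> 1); rewrite subrr /dot; under eq_bigr do rewrite mulr1.
  have := fiedler_critical sum_cut g0.
  rewrite aE => /(_ rayleigh_cut); rewrite dirichletC.
  have sub u w : cut u - cut w = indic R S u - indic R S w by rewrite /cut; ring.
  rewrite (eq_dirichlet (fun _ _ => erefl) sub) dirichletE dotg !lap_op_indic //.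
  have -> : dot cut g = dot g cut by apply: eq_bigr => w _; rewrite mulrC.
  rewrite dotg sub /indic vS v0S subrr mulr0 => /eqP.
  by rewrite subr_eq0 eqr_nat => /eqP.
exists (deg_in (~: S) v0); split=> //.
have := dirichlet_indicC R S; rewrite dirichlet_indic sum_deg_in => /eqP.
by rewrite eqr_nat (eq_bigr _ const) sum_nat_const mulnC => /eqP.
Qed.

End RegularSubset.

Theorem corollary16 (R : rcfType) (G : sgraph) (kappa tau : nat) (S : {set G})
    (hE : exists x y : G, adj x y)
    (hS : regular_subset kappa tau S)
    (hkt : tau%:Z - kappa%:Z <= 1) :
  let n := #|G| in
  let n1 := #|S| in
  lap_spread R G >= (max_degree G)%:R + 1 - (tau * n)%:R / n1%:R
  /\ (lap_spread R G = (max_degree G)%:R + 1 - (tau * n)%:R / n1%:R ->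
      (exists s : nat, {in S, forall v, deg_in (~: S) v = s}
                       /\ (s * n1 = tau * (n - n1))%N)
      /\ lap_eig R G 1 = (max_degree G)%:R + 1
      /\ alg_connectivity R G = (tau * n)%:R / n1%:R).
Proof.
move=> n n1; case: hS => S0 SP _ Stau.
have mu1 := lap_eig1_ge_max_degree R hE.
have a_le := alg_connectivity_le_regular R S0 SP Stau.
rewrite /lap_spread; split; first lra.
move=> spread.
have mu1E : lap_eig R G 1 = (max_degree G)%:R + 1 by lra.
have aE : alg_connectivity R G = (tau * n)%:R / n1%:R by lra.
split; last by [].
exact: regular_of_alg_connectivity_eq S0 SP Stau aE.
Qed.
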